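(* Let $X$ be a nonempty finite set of feasible solutions and $f\colon X\to\mathbb{R}$ a cost function, where the minimum value of $f$ and the number of minimizers are unknown to the algorithm. Let $\epsilon \in (0, 1/\mathrm{e}^{1.5})$. Suppose a cost-ordered fair sampler on $X$ is available, i.e., it returns independent samples distributed according to a probability distribution $p$ on $X$ satisfying, for all $x_1,x_2\in X$: $f(x_1)<f(x_2)\Rightarrow p(x_1)\ge p(x_2)$, and $f(x_1)=f(x_2)\Rightarrow p(x_1)=p(x_2)$. Run Algorithm 2 (defined in the context) with this sampler and tolerance $\epsilon$. Then Algorithm 2 returns exactly the set $\operatorname{argmin}_{x\in X} f(x)$ of all optimal solutions with probability exceeding $1-\epsilon$, regardless of the minimum value of $f$ and the number of optimal solutions.
   Context: Define $\alpha \coloneqq \ln(1/\epsilon) - 1$, $\beta \coloneqq \frac{\frac{1}{\mathrm{e}} + \frac{1}{3}\ln\frac{1}{3}}{\frac{1}{\mathrm{e}} - \frac{1}{3}}\,\alpha$, and \[ \kappa_2 \coloneqq \frac{4^\alpha}{1-\mathrm{e}^{-\beta}}\left(\zeta(2\alpha) - \sum_{k=1}^5 \frac{1}{k^{2\alpha}}\right) + \frac{2-\mathrm{e}^{-\frac{\alpha}{\mathrm{e}-1}}}{\left(1-\mathrm{e}^{-\frac{\alpha}{\mathrm{e}-1}}\right)^2}, \] where $\zeta$ is the Riemann zeta function. Algorithm 2: Draw one sample $x$; set $\theta=f(x)$, $S=\{x\}$, sample count $\tau=1$, and $m=2$. Repeatedly draw samples $y$: if $f(y)>\theta$, discard $y$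 (it is not counted in $\tau$); if $f(y)=\theta$, increment $\tau$ and add $y$ to $S$; if $f(y)<\theta$, set $\theta=f(y)$, $S=\{y\}$, $\tau=1$, $m=2$ (restart collection for the new provisional minimum cost). Whenever $\tau$ reaches $\lceil m\ln(m\kappa_2/\epsilon)\rceil$ without $\theta$ having been lowered: if $|S|<m$, halt and return $S$; otherwise increase $m$ by one and continue. *)

(* Defs.v *)
From HB Require Import structures.
From mathcomp Require Import all_boot all_order all_algebra finmap.
From mathcomp Require Import all_classical all_reals all_analysis.

Set Implicit Arguments.
Unset Strict Implicit.
Unset Printing Implicit Defensive.

Import Order.TTheory GRing.Theory Num.Theory.
Import numFieldNormedType.Exports.

Local Open Scope classical_set_scope.
Local Open Scope ring_scope.

(* Riemann zeta function at a real argument s > 1, where the series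
   converges; [riemannR s k] is [1 / (k + 1) `^ s]. *)
Definition zeta (R : realType) (s : R) : R := limn (series (riemannR s)).

Definition alpha (R : realType) (eps : R) : R := ln (1 / eps) - 1.

Definition beta (R : realType) (eps : R) : R :=
  (1 / expR 1 + 1 / 3 * ln (1 / 3)) / (1 / expR 1 - 1 / 3) * alpha eps.

Definition kappa2 (R : realType) (eps : R) : R :=
  let a := alpha eps in
  let b := beta eps in
  let r := expR (- (a / (expR 1 - 1))) in
  (4 `^ a) / (1 - expR (- b))
    * (zeta (2 * a) - \sum_(1 <= k < 6) 1 / (k%:R `^ (2 * a)))
  + (2 - r) / (1 - r) ^+ 2.

Definition threshold (R : realType) (eps : R) (m : nat) : int :=
  Num.ceil (m%:R * ln (m%:R * kappa2 eps / eps)).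

(* Configurations of the algorithm. [Running theta A tau m n] is a run still in
   progress, [n] being the number of samples drawn so far, including discarded
   ones; [Returned A] is a run that has halted with output [A]. *)
Inductive config (R : realType) (X : finType) : Type :=
  | Running (theta : R) (A : {set X}) (tau m n : nat)
  | Returned (A : {set X}).

Arguments Returned R {X} A.

Definition start (R : realType) (X : finType) (f : X -> R) (s : nat -> X) :
    config R X :=
  Running (f (s 0%N)) [set s 0%N]%SET 1 2 1.

(* One transition on the stream of samples [s]: either the test for the current
   [m], made without drawing, or the draw of the next sample [s n]. *)
Definition step (R : realType) (X : finType) (f : X -> R) (eps : R)
    (s : nat -> X) (c : config R X) : config R X :=
  match c with
  | Returned A => Returned R A
  | Running theta A tau m n =>
      if threshold eps m <= tau%:Z then
        if (#|A| < m)%N then Returned R A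
        else Running theta A tau m.+1 n
      else
        let y := s n in
        if theta < f y then Running theta A tau m n.+1
        else if f y == theta then Running theta (y |: A)%SET tau.+1 m n.+1
        else Running (f y) [set y]%SET 1 2 n.+1
  end.

Definition returns (R : realType) (X : finType) (f : X -> R) (eps : R)
    (s : nat -> X) (A : {set X}) : Prop :=
  exists k : nat, iter k (step f eps s) (start f s) = Returned R A.

Definition argmin (R : realType) (X : finType) (f : X -> R) : {set X} :=
  [set x | [forall y, f x <= f y]]%SET.

Definition prob_distribution (R : realType) (X : finType) (p : X -> R) : Prop :=
  (forall x, 0 <= p x) /\ \sum_(x : X) p x = 1.

Definition cost_ordered_fair (R : realType) (X : finType) (f p : X -> R) :
    Prop :=
  forall x1 x2 : X,
    (f x1 < f x2 -> p x2 <= p x1) /\ (f x1 = f x2 -> p x1 = p x2).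

(* [Y] is a sequence of mutually independent random elements of the finite set
   [X] (with its discrete sigma-algebra), each of law [p]. *)
Definition independent_samples (R : realType) (d : measure_display)
    (T : measurableType d) (P : probability T R) (X : finType)
    (Y : nat -> T -> X) (p : X -> R) : Prop :=
  [/\ forall (n : nat) (B : set X), measurable (Y n @^-1` B),
      forall (n : nat) (x : X), P (Y n @^-1` [set x]) = (p x)%:E
    & forall (J : {fset nat}) (B : nat -> set X),
        P (\bigcap_(j in [set` J]) (Y j @^-1` B j)) =
        (\prod_(j <- J) P (Y j @^-1` B j))%E ].

(* Main.v *)
(** When a run halts at cost [theta] with test value [m], passing the earlier
    tests forces [#|A| = m - 1], and [A] is the set of all samples so far of
    cost at most [theta].  So a wrong output [A] means that the first [t_m]
    samples falling in the sublevel set [B] of [A] all lie in [A]; by fairness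
    this has probability at most [(#|A| / #|B|) ^ t_m].  We sum over all wrong
    [A].  Writing [N = #|B|] and [k = m - 1], the choice of [t_m] gives
    [C(N, k) (k / N) ^ t_m <= (eps / kappa2) exp (- alpha m ln (N / m))].  By
    concavity of [ln], resp. of [- x ln x], the exponential is at most
    [r ^ (N - m)] if [N <= e m], and otherwise [N >= 6] and it is at most
    [(2 / N) ^ (2 alpha) exp (- beta (m - 2))].  Distinct cost levels have
    distinct [N] and distinct numbers of strictly cheaper solutions, so the
    sum over the levels is dominated by the zeta tail and the double geometric
    series that make up [kappa2].  Finally, the run has halted once
    sufficiently many minimizers were drawn, which happens almost surely. *)

Require Import Defs.
From HB Require Import structures.
From mathcomp Require Import all_boot all_order all_algebra finmap.
From mathcomp Require Import all_classical all_reals all_analysis.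
From mathcomp Require Import ring lra zify.

Import Order.TTheory GRing.Theory Num.Theory.
Import numFieldNormedType.Exports.

Local Open Scope classical_set_scope.
Local Open Scope ring_scope.

Set Implicit Arguments.
Unset Strict Implicit.
Unset Printing Implicit Defensive.

(** * Concavity estimates *)

Lemma ln_le_subr1 (R : realType) (x : R) : 0 < x -> ln x <= x - 1.
Proof.
move=> x0; have := @le_ln1Dx R (x - 1).
by rewrite subrKC; apply; lra.
Qed.

Lemma ln_le_tangent (R : realType) (a c : R) : 0 < a -> 0 < c ->
  ln a <= ln c + a / c - 1.
Proof.
move=> a0 c0; have := ln_le_subr1 (divr_gt0 a0 c0).
by rewrite ln_div ?posrE//; lra.
Qed.

(** Average the tangent bounds at the mean [c]: the linear terms cancel. *)
Lemma ln_concave (R : realType) (l a b : R) : 0 <= l <= 1 -> 0 < a -> 0 < b ->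
  l * ln a + (1 - l) * ln b <= ln (l * a + (1 - l) * b).
Proof.
move=> /andP[l0 l1] a0 b0; set c := l * a + _.
have c0 : 0 < c by rewrite /c; nra.
have Ha := ler_wpM2l l0 (ln_le_tangent a0 c0).
have Hb : (1 - l) * ln b <= (1 - l) * (ln c + b / c - 1).
  by apply: ler_wpM2l (ln_le_tangent b0 c0); lra.
have E : l * (ln c + a / c - 1) + (1 - l) * (ln c + b / c - 1) = ln c.
  have -> : l * (ln c + a / c - 1) + (1 - l) * (ln c + b / c - 1) =
    ln c + (c / c - 1) by rewrite /c; ring.
  by rewrite divff ?gt_eqF// subrr addr0.
lra.
Qed.

(** The tangent of [ln] at [a], evaluated at [c] and multiplied by [a], is the tangent of [- x ln x]
    at [c]. *)
Lemma xlnx_le_tangent (R : realType) (a c : R) : 0 < a -> 0 < c ->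
  - (a * ln a) <= - (a * ln c) + c - a.
Proof.
move=> a0 c0; have := ler_wpM2l (ltW a0) (ln_le_tangent c0 a0).
have -> : a * (ln a + c / a - 1) = a * ln a + c - a.
  by field; rewrite gt_eqF.
lra.
Qed.

Lemma xlnx_concave (R : realType) (l a b : R) : 0 <= l <= 1 -> 0 < a -> 0 < b ->
  l * (- (a * ln a)) + (1 - l) * (- (b * ln b)) <=
  - ((l * a + (1 - l) * b) * ln (l * a + (1 - l) * b)).
Proof.
move=> /andP[l0 l1] a0 b0; set c := l * a + _.
have c0 : 0 < c by rewrite /c; nra.
have Ha := ler_wpM2l l0 (xlnx_le_tangent a0 c0).
have Hb : (1 - l) * (- (b * ln b)) <= (1 - l) * (- (b * ln c) + c - b).
  by apply: ler_wpM2l (xlnx_le_tangent b0 c0); lra.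
have E : l * (- (a * ln c) + c - a) + (1 - l) * (- (b * ln c) + c - b) =
  - (c * ln c) by rewrite /c; ring.
lra.
Qed.

Lemma expR1_lt3 (R : realType) : expR 1 < 3 :> R.
Proof.
(* The sixth power suffices: [(5/6) ^ 6 > 1/3]. *)
have H : 1 + - 6^-1 <= expR (- 6^-1) :> R := expR_ge1Dx _.
have : (1 + - 6^-1) ^+ 6 <= expR (- 6^-1) ^+ 6 :> R.
  by rewrite lerXn2r// nnegrE ?expR_ge0//; lra.
rewrite -expRM_natr mulNr mulVf ?pnatr_eq0// expRN.
set e : R := expR 1 => He.
have e0 : 0 < e by exact: expR_gt0.
have : 1 / 3 < e^-1 by apply: lt_le_trans He; lra.
by rewrite div1r ltf_pV2 ?posrE.
Qed.

Lemma expR1_gt (R : realType) : 5 / 2 < expR 1 :> R.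
Proof.
(* Here [(7/6) ^ 6 > 5/2]. *)
have H : 1 + 6^-1 <= expR 6^-1 :> R := expR_ge1Dx _.
have : (1 + 6^-1) ^+ 6 <= expR 6^-1 ^+ 6 :> R.
  by rewrite lerXn2r// nnegrE ?expR_ge0//; lra.
rewrite -expRM_natr mulVf ?pnatr_eq0//.
by apply: lt_le_trans; lra.
Qed.

Lemma inv_lt_invexpR1 (R : realType) : 1 / 3 < 1 / expR 1 :> R.
Proof. by rewrite !div1r ltf_pV2 ?posrE ?expR_gt0// expR1_lt3. Qed.

(* Slope of the chord of -x ln x between 1/3 and its maximum at 1/e. *)
Definition slope3 (R : realType) : R :=
  (1 / expR 1 + 1 / 3 * ln (1 / 3)) / (1 / expR 1 - 1 / 3).

Lemma betaE (R : realType) (eps : R) : beta eps = slope3 R * alpha eps.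
Proof. by []. Qed.

(** The numerator is positive because [ln y < y - 1] at [y = 3 / e], strictly since [y] differs from
    [1]. *)
Lemma slope3_gt0 (R : realType) : 0 < slope3 R.
Proof.
have e3 := inv_lt_invexpR1 R; have el := expR1_lt3 R.
have e0 : 0 < expR 1 :> R by exact: expR_gt0.
apply: divr_gt0; last lra.
have H : 3 / expR 1 != 1 :> R.
  by rewrite gt_eqF// ltr_pdivlMr// mul1r.
have lt3 : ln (3 / expR 1) < 3 / expR 1 - 1 :> R.
  have p : 0 < 3 / expR 1 :> R by exact: divr_gt0.
  have : ln (3 / expR 1) != 0 :> R by rewrite ln_eq0.
  move=> /expR_gt1Dx; rewrite lnK ?posrE//; lra.
move: lt3; rewrite ln_div ?posrE// expRK !div1r lnV ?posrE//.
lra.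
Qed.

(** By concavity the graph lies above its chord over [[a, 1/e]], which is at least as steep as the
    chord from [1/3] because [a <= 1/3]. *)
Lemma xlnx_chord_lo (R : realType) (a x : R) : 0 < a -> a <= 1 / 3 ->
  a <= x -> x <= 1 / expR 1 ->
  - (a * ln a) + slope3 R * (x - a) <= - (x * ln x).
Proof.
move=> a0 a3 ax xe; have e3 := inv_lt_invexpR1 R.
have x0 : 0 < x by lra.
set q : R := 1 / expR 1 in xe e3.
have q0 : 0 < q by lra.
have hq : - (q * ln q) = q.
  by rewrite /q div1r lnV ?posrE ?expR_gt0// expRK mulrN1 opprK.
have sE : slope3 R * (q - 1 / 3) = q + 1 / 3 * ln (1 / 3).
  by rewrite /slope3 -/q mulfVK// gt_eqF// subr_gt0.
have qa : 0 < q - a by lra.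
(* The chord bound between [a] and [q], cleared of the denominator [q - a]. *)
have cvx y : a <= y <= q ->
    (y - a) * q + (q - y) * (- (a * ln a)) <= (q - a) * (- (y * ln y)).
  move=> /andP[ay yq]; pose l := (y - a) / (q - a).
  have lE : l * (q - a) = y - a by rewrite /l mulfVK// gt_eqF.
  have l01 : 0 <= l <= 1.
    rewrite /l divr_ge0 ?subr_ge0//=; last lra.
    by rewrite ler_pdivrMr// mul1r; lra.
  have := @xlnx_concave R l q a l01 q0 a0.
  have -> : l * q + (1 - l) * a = y.
    by rewrite -[y](subrK a) -lE; ring.
  rewrite hq => /(ler_wpM2l (ltW qa)); apply: le_trans.
  rewrite (_ : (q - a) * _ = (l * (q - a)) * q +
    ((q - a) - l * (q - a)) * - (a * ln a)); last ring.
  rewrite lE le_eqVlt; apply/orP; left; apply/eqP; ring.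
have H3 := cvx (1 / 3); have Hx := cvx x.
have {H3}H3 : (1 / 3 - a) * q + (q - 1 / 3) * - (a * ln a) <=
    (q - a) * - (1 / 3 * ln (1 / 3)).
  by apply: H3; apply/andP; split; lra.
have {}Hx : (x - a) * q + (q - x) * - (a * ln a) <= (q - a) * - (x * ln x).
  by apply: Hx; apply/andP; split; lra.
rewrite -(ler_pM2l qa); apply: le_trans Hx.
have : slope3 R * (q - a) <= q - - (a * ln a).
  rewrite -(ler_pM2l (_ : 0 < q - 1 / 3)); last lra.
  rewrite (_ : _ * (slope3 R * _) = (slope3 R * (q - 1/3)) * (q - a)); last ring.
  rewrite sE; move: H3; set L := ln _; set A := a * ln a; nra.
move=> /(ler_wpM2l (_ : 0 <= x - a)) H.
have {}H := H ltac:(lra); move: H.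
set A := a * ln a; nra.
Qed.

(** The chord of the concave [ln] between its values [0] at [1] and [1] at [e]. *)
Lemma ln_chord_e (R : realType) (y : R) : 1 <= y -> y <= expR 1 ->
  (y - 1) / (expR 1 - 1) <= ln y.
Proof.
move=> y1 ye; have e52 := expR1_gt R.
set e : R := expR 1 in ye e52 *.
have e1 : 0 < e - 1 by lra.
set l := (y - 1) / _.
have lE : l * (e - 1) = y - 1 by rewrite /l mulfVK// gt_eqF.
have l01 : 0 <= l <= 1.
  rewrite /l divr_ge0 ?subr_ge0//=; last lra.
  by rewrite ler_pdivrMr// mul1r; lra.
have := @ln_concave R l e 1 l01 (expR_gt0 _) ltr01.
rewrite ln1 mulr0 addr0 {1}/e expRK !mulr1.
suff -> : l * e + (1 - l) = y by [].
by rewrite -[y](subrK 1) -lE; ring.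
Qed.

(** * Bounds for one cost level *)

Lemma ln_succ_sub (R : realType) (k : nat) : (0 < k)%N ->
  1 <= k.+1%:R * (ln k.+1%:R - ln k%:R) :> R.
Proof.
move=> k0; have K0 : 0 < k%:R :> R by rewrite ltr0n.
have K1 : 0 < k.+1%:R :> R by rewrite ltr0n.
have := ln_le_subr1 (divr_gt0 K0 K1).
rewrite ln_div ?posrE// => /(ler_wpM2l (ltW K1)).
rewrite [X in _ <= X](_ : _ = -1); first nra.
by field; rewrite /= ?nat1r ?gt_eqF// -natr1; lra.
Qed.

(** [(u - k) / u] is the mean of [1 / (k+1)] and [1] with weights [(k+1) / u] and
    [1 - (k+1) / u]. *)
Lemma ln_sub_le (R : realType) (k : nat) (u : R) : k.+1%:R <= u ->
  u * (ln u - ln (u - k%:R)) <= k.+1%:R * ln k.+1%:R.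
Proof.
move=> ku; have K1 : 0 < k.+1%:R :> R by rewrite ltr0n.
have u0 : 0 < u by lra.
have uk0 : 0 < u - k%:R by rewrite -natr1 in ku; lra.
pose l := k.+1%:R / u.
have l01 : 0 <= l <= 1.
  by rewrite divr_ge0 ?ler0n ?(ltW u0)//= ler_pdivrMr// mul1r.
have := @ln_concave R l k.+1%:R^-1 1 l01.
rewrite invr_gt0 => /(_ K1 ltr01).
have -> : l * k.+1%:R^-1 + (1 - l) * 1 = (u - k%:R) / u.
  rewrite /l mulr1 mulrAC divff ?gt_eqF// mulrBl divff ?gt_eqF//.
  by rewrite -natr1 mulrDl; ring.
rewrite lnV ?posrE// ln1 mulr0 addr0 ln_div ?posrE//.
move=> /(ler_wpM2l (ltW u0)).
rewrite (_ : u * (l * _) = - (k.+1%:R * ln k.+1%:R)); first nra.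
by rewrite /l; field; rewrite gt_eqF.
Qed.

(* Induction on [N]: each step is [ln_sub_le], the concavity of [ln] on
   [[1/(k+1), 1]]. *)
Lemma ln_bin_le (R : realType) (N k : nat) : (0 < k < N)%N ->
  ln ('C(N, k)%:R) + 1 <=
  k.+1%:R * (1 + ln k.+1%:R) * (ln N%:R - ln k%:R) :> R.
Proof.
move=> /andP[k0 kN]; rewrite -(subnK kN); move: (N - k.+1)%N => s.
have L0 : 0 <= ln k.+1%:R :> R by apply: ln_ge0; rewrite ler1n.
elim: s => [|s IH].
  rewrite add0n binSn; have := ln_succ_sub R k0; nra.
rewrite addSn; move: IH; set n := (s + k.+1)%N => IH.
have kn : (k < n)%N by rewrite /n; lia.
have n0 : 0 < n%:R :> R by rewrite ltr0n; lia.
have n1 : 0 < n.+1%:R :> R by rewrite ltr0n.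
have nk : 0 < (n.+1 - k)%:R :> R by rewrite ltr0n; lia.
have C0 : 0 < 'C(n, k)%:R :> R by rewrite ltr0n bin_gt0; lia.
have C1 : 0 < 'C(n.+1, k)%:R :> R by rewrite ltr0n bin_gt0; lia.
have E : ln 'C(n.+1, k)%:R = ln 'C(n, k)%:R + ln n.+1%:R - ln (n.+1 - k)%:R :> R.
  have /(congr1 (fun i => ln (i%:R : R))) := mul_bin_down n.+1 k.
  by rewrite /= !natrM !lnM ?posrE//; lra.
(* After multiplication by [n+1], the left side is at most [(k+1) ln (k+1)] and the right side at
   least [(k+1) (1 + ln (k+1))]. *)
have Hs : ln n.+1%:R - ln (n.+1 - k)%:R <=
    k.+1%:R * (1 + ln k.+1%:R) * (ln n.+1%:R - ln n%:R) :> R.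
  have := @ln_sub_le R k n.+1%:R; rewrite -natrB; last lia.
  rewrite ler_nat => /(_ ltac:(lia)) H1.
  have H2 : 1 <= n.+1%:R * (ln n.+1%:R - ln n%:R) :> R by apply: ln_succ_sub; lia.
  rewrite -(ler_pM2l n1) (le_trans H1)//.
  rewrite mulrCA -mulrA; apply: ler_wpM2l => //.
  have : 0 <= (1 + ln k.+1%:R) * (n.+1%:R * (ln n.+1%:R - ln n%:R) - 1) :> R.
    by apply: mulr_ge0; lra.
  lra.
rewrite E; lra.
Qed.

Section term_bounds.
Variables (R : realType) (eps : R).
Hypothesis alpha_gt0 : 0 < alpha eps.

Definition level_term (N m : nat) : R :=
  expR (- (alpha eps * (m%:R * (ln N%:R - ln m%:R)))).

(** In logarithms, with [m = k+1] and [D = ln N - ln k], the binomial contributes at most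
    [m (1 + ln m) D - 1] and the power at most [- m D (ln m + ln kap + alpha + 1)], since
    [- ln eps = alpha + 1]. The rest follows from [m D >= 1 + m ln (N / m)]. *)
Lemma bin_expr_le (N k t : nat) (kap : R) : 0 < eps -> (0 < k < N)%N -> 1 <= kap ->
  k.+1%:R * ln (k.+1%:R * kap / eps) <= t%:R ->
  'C(N, k)%:R * (k%:R / N%:R) ^+ t <= eps / kap * level_term N k.+1.
Proof.
move=> eps_gt0 /andP[k0 kN] kap1 ht.
have K0 : 0 < k%:R :> R by rewrite ltr0n.
have M0 : 0 < k.+1%:R :> R by rewrite ltr0n.
have N0 : 0 < N%:R :> R by rewrite ltr0n; lia.
have C0 : 0 < 'C(N, k)%:R :> R by rewrite ltr0n bin_gt0; lia.
have kap0 : 0 < kap by lra.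
rewrite -[X in X * _ ^+ _]lnK ?posrE//.
rewrite -[k%:R / N%:R]lnK ?posrE ?divr_gt0// -expRM_natl ln_div ?posrE//.
rewrite -[eps / kap]lnK ?posrE ?divr_gt0// ln_div ?posrE//.
rewrite /level_term -!expRD ler_expR.
move: ht; rewrite ln_div ?posrE ?mulr_gt0// lnM ?posrE//.
have := @ln_bin_le R N k; rewrite k0 kN => /(_ isT).
have aE : alpha eps = - ln eps - 1 by rewrite /alpha div1r lnV ?posrE.
have H1 := ln_succ_sub R k0.
have LK : 0 <= ln kap by apply: ln_ge0.
have LN : ln k.+1%:R <= ln N%:R :> R by rewrite ler_ln ?posrE// ler_nat.
have LE : ln eps = - (alpha eps + 1) by lra.
rewrite LE; move: H1 LK LN alpha_gt0.
set m := k.+1%:R; set lm := ln m; set lk := ln k%:R; set lN := ln N%:R.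
set al := alpha eps; set C := ln 'C(N, k)%:R; set lka := ln kap.
move=> H1 LK LN al0 HC ht.
pose D := lN - lk.
have mD : 1 + m * (lN - lm) <= m * D by rewrite /D; lra.
have w0 : 0 <= m * (lN - lm) by apply: mulr_ge0; [exact: ltW|lra].
have D0 : 0 <= D.
  have : 0 < m * D by lra.
  by rewrite pmulr_rgt0// => /ltW.
have hD := ler_wpM2r D0 ht.
have e1 : 0 <= lka * (m * D - 1) by apply: mulr_ge0; lra.
have e2 : 0 <= al * (m * D - (1 + m * (lN - lm))) by apply: mulr_ge0; lra.
rewrite /D in hD e1 e2 *; lra.
Qed.

(** Ratio of the decay in [N - m] when [N <= e m]; [ratio_lo] is the ratio of the decay in [m] for
    larger [N]. *)
Definition ratio_hi : R := expR (- (alpha eps / (expR 1 - 1))).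

Definition ratio_lo : R := expR (- beta eps).

Lemma ratio_hi_lt1 : 0 < ratio_hi < 1.
Proof.
by rewrite expR_gt0 expR_lt1 oppr_lt0 divr_gt0// subr_gt0 expR_gt1.
Qed.

Lemma ratio_lo_lt1 : 0 < ratio_lo < 1.
Proof.
by rewrite expR_gt0 expR_lt1 oppr_lt0 betaE mulr_gt0// slope3_gt0.
Qed.

Lemma level_term_hi (N m : nat) : (0 < m <= N)%N -> N%:R <= expR 1 * m%:R :> R ->
  level_term N m <= ratio_hi ^+ (N - m).
Proof.
move=> /andP[m0 mN] Ne.
have M0 : 0 < m%:R :> R by rewrite ltr0n.
have N0 : 0 < N%:R :> R by rewrite ltr0n; lia.
have e52 := expR1_gt R.
rewrite /ratio_hi -expRM_natl ler_expR mulrN lerN2 natrB//.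
have : (N%:R / m%:R - 1) / (expR 1 - 1) <= ln (N%:R / m%:R) :> R.
  by apply: ln_chord_e; rewrite ?ler_pdivlMr ?ler_pdivrMr// mul1r ler_nat.
rewrite ln_div ?posrE// => /(ler_wpM2l (ltW M0)) /(ler_wpM2l (ltW alpha_gt0)).
apply: le_trans; rewrite le_eqVlt; apply/orP; left; apply/eqP.
by field; rewrite !gt_eqF//; lra.
Qed.

(** This is [xlnx_chord_lo] at [a = 2 / N] and [x = m / N], multiplied by [N]. Its condition
    [a <= 1/3] means [N >= 6], which holds since [N > e m > 5]. *)
Lemma level_term_lo (N m : nat) : (2 <= m)%N -> expR 1 * m%:R < N%:R :> R ->
  (6 <= N)%N /\
  level_term N m <= 4 `^ alpha eps / N%:R `^ (2 * alpha eps) * ratio_lo ^+ (m - 2).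
Proof.
move=> m2 eN; have e52 := expR1_gt R.
have M2 : 2 <= m%:R :> R by rewrite ler_nat.
have M0 : 0 < m%:R :> R by lra.
have N5 : (5 < N)%N by rewrite -(ltr_nat R); nra.
split=> //.
have N6 : 6 <= N%:R :> R by rewrite ler_nat.
have N0 : 0 < N%:R :> R by lra.
rewrite /powR !gt_eqF// -expRN /ratio_lo -expRM_natl -!expRD ler_expR betaE.
have -> : ln 4 = 2 * ln 2 :> R.
  by rewrite (_ : 4 = 2 * 2) ?lnM ?posrE//; lra.
have := @xlnx_chord_lo R (2 / N%:R) (m%:R / N%:R).
rewrite divr_gt0// ler_pdivrMr// => /(_ isT ltac:(lra)).
rewrite ler_pM2r ?invr_gt0// => /(_ M2).
rewrite ler_pdivrMr// div1r ler_pdivlMl// => /(_ (ltW eN)).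
rewrite !ln_div ?posrE// => /(ler_wpM2l (ltW N0)) H.
have {H} H : 2 * (ln N%:R - ln 2) + slope3 R * (m%:R - 2) <=
    m%:R * (ln N%:R - ln m%:R).
  apply: le_trans (le_trans _ H) _; rewrite le_eqVlt; apply/orP; left; apply/eqP.
    by field; rewrite gt_eqF.
  by field; rewrite gt_eqF.
have := ler_wpM2l (ltW alpha_gt0) H.
rewrite natrB//; lra.
Qed.

(** Adding the bounds of both regimes avoids a case split in later sums; the indicator matches a
    zeta tail starting at [6]. *)
Lemma level_term_le (N m : nat) : (2 <= m <= N)%N ->
  level_term N m <=
  (6 <= N)%N%:R * (4 `^ alpha eps / N%:R `^ (2 * alpha eps)) * ratio_lo ^+ (m - 2)
  + ratio_hi ^+ (N - m).
Proof.
move=> /andP[m2 mN].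
have [Ne|eN] := leP N%:R (expR 1 * m%:R : R).
  apply: le_trans (level_term_hi _ Ne) _; first by apply/andP; split; lia.
  by rewrite lerDr !mulr_ge0 ?ler0n ?powR_ge0 ?exprn_ge0 ?invr_ge0 ?powR_ge0 ?expR_ge0.
have [N6 H] := level_term_lo m2 eN.
by apply: le_trans H _; rewrite N6 mul1r lerDl exprn_ge0 ?expR_ge0.
Qed.

End term_bounds.

(** Strictness matters: through [sum_wrong_weight_lt] it leaves room below [eps] for the event that
    too few minimizers are drawn. *)
Lemma geometric_sum_lt (R : realType) (q : R) (n : nat) : 0 < q < 1 ->
  \sum_(i < n) q ^+ i < (1 - q)^-1.
Proof.
move=> /andP[q0 q1]; have q1' : 0 < 1 - q by lra.
rewrite -[X in _ < X]mul1r ltr_pdivlMr//.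
have -> : (\sum_(i < n) q ^+ i) * (1 - q) = 1 - q ^+ n.
  elim: n => [|n IH]; first by rewrite big_ord0 mul0r expr0 subrr.
  by rewrite big_ord_recr /= mulrDl IH exprS; ring.
by rewrite ltrBlDr ltrDl exprn_gt0.
Qed.

Section level_sum.
Variables (R : realType) (eps : R).
Hypothesis alpha_gt0 : 0 < alpha eps.

Lemma level_sum_lt (N K : nat) : (K < N)%N ->
  \sum_(1 <= k < K.+1) level_term eps N k.+1 <
  (6 <= N)%N%:R * (4 `^ alpha eps / N%:R `^ (2 * alpha eps)) / (1 - ratio_lo eps)
  + ratio_hi eps ^+ (N - K.+1) / (1 - ratio_hi eps).
Proof.
move=> KN; set c := _ %:R * (_ / _); set q := ratio_lo eps; set r := ratio_hi eps.
have /andP[q0 q1] : 0 < q < 1 := ratio_lo_lt1 alpha_gt0.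
have /andP[r0 r1] : 0 < r < 1 := ratio_hi_lt1 alpha_gt0.
have c0 : 0 <= c by rewrite !mulr_ge0 ?ler0n ?powR_ge0 ?invr_ge0 ?powR_ge0.
apply: (@le_lt_trans _ _ (\sum_(1 <= k < K.+1) (c * q ^+ k.-1 + r ^+ (N - k.+1)))).
  rewrite big_nat_cond [leRHS]big_nat_cond; apply: ler_sum => k /andP[/andP[k1 kK] _].
  have := @level_term_le R eps alpha_gt0 N k.+1.
  by rewrite -subn1 subSS; apply; apply/andP; split; lia.
rewrite big_split /= -mulr_sumr.
have Hlo : \sum_(1 <= k < K.+1) q ^+ k.-1 <= (1 - q)^-1.
  rewrite big_add1 /= big_mkord.
  by apply/ltW/geometric_sum_lt; rewrite q0 q1.
(* The exponent is smallest at [k = K]; reversing the sum factors that power out. *)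
have -> : \sum_(1 <= k < K.+1) r ^+ (N - k.+1) = r ^+ (N - K.+1) * \sum_(i < K) r ^+ i.
  rewrite big_add1 /= big_nat_rev /= big_mkord mulr_sumr.
  apply: eq_bigr => i _; rewrite -exprD; congr (_ ^+ _).
  by have := ltn_ord i; lia.
apply: ler_ltD; first exact: ler_wpM2l.
by rewrite ltr_pM2l ?exprn_gt0//; apply: geometric_sum_lt; rewrite r0 r1.
Qed.

End level_sum.

(** A discrete integral test: with [dl = s - 1], the terms are dominated by the differences of
    [k ^ (- dl) / dl], which telescope. *)
Lemma cvg_riemannR (R : realType) (s : R) : 1 < s ->
  cvgn (series (riemannR s)).
Proof.
move=> s1; apply: nondecreasing_is_cvgn.
  by apply: nondecreasing_series => n _ _; apply/ltW/riemannR_gt0; lra.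
pose dl := s - 1; have dl0 : 0 < dl by rewrite /dl; lra.
exists (1 + dl^-1) => _ [n _ <-].
have telescope k : (k.+2%:R `^ s)^-1 <=
    dl^-1 * (expR (- (dl * ln k.+1%:R)) - expR (- (dl * ln k.+2%:R))) :> R.
  have k1 : 0 < k.+1%:R :> R by rewrite ltr0n.
  have k2 : 0 < k.+2%:R :> R by rewrite ltr0n.
  rewrite ler_pdivlMl// /powR gt_eqF// -expRN.
  have -> : - (s * ln k.+2%:R) = - (dl * ln k.+2%:R) - ln k.+2%:R :> R.
    by rewrite /dl; ring.
  have -> : - (dl * ln k.+1%:R) =
      - (dl * ln k.+2%:R) + dl * (ln k.+2%:R - ln k.+1%:R) :> R by ring.
  rewrite expRB lnK ?posrE// expRD.
  (* Together [H1] and [H2] give [(k+1) ^ (- dl) >= (k+2) ^ (- dl) (1 + dl / (k+2))]. *)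
  have H1 : 1 <= k.+2%:R * (ln k.+2%:R - ln k.+1%:R) :> R by exact: ln_succ_sub.
  have H2 := expR_ge1Dx (dl * (ln k.+2%:R - ln k.+1%:R)).
  set e := expR (- _); have e0 : 0 < e by exact: expR_gt0.
  rewrite -[X in _ <= _ - X]mulr1 -mulrBr mulrCA ler_pM2l//.
  rewrite ler_pdivrMr//.
  have := ler_wpM2r (ltW k2) H2; have := ler_wpM2l (ltW dl0) H1; lra.
have bound m : series (riemannR s) m.+1 <=
    1 + dl^-1 - dl^-1 * expR (- (dl * ln m.+1%:R)).
  rewrite seriesEnat /=; elim: m => [|m IH].
    by rewrite big_nat1 ln1 mulr0 oppr0 expR0 /riemannR (powR1 R) /= invr1; lra.
  rewrite big_nat_recr//=; have := telescope m.
  rewrite -/(riemannR s m.+1); lra.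
case: n => [|n]; first by rewrite seriesEnat /= big_geq// addr_ge0// invr_ge0 ltW.
apply: le_trans (bound n) _.
by rewrite lerBlDr lerDl mulr_ge0 ?expR_ge0// invr_ge0 ltW.
Qed.

Lemma zeta_tail_ge (R : realType) (s : R) (K : nat) : 1 < s ->
  \sum_(6 <= n < K) (n%:R `^ s)^-1 <=
  zeta s - \sum_(1 <= k < 6) 1 / (k%:R `^ s).
Proof.
move=> s1; have [K6|K6] := leqP K 6.
  (* The sum is empty; the tail is nonnegative by comparison with the fifth partial sum. *)
  rewrite big_geq//; set z := _ - _.
  have : series (riemannR s) 5 <= zeta s.
    apply: nondecreasing_cvgn_le (cvg_riemannR s1) _.
    by apply: nondecreasing_series => n _ _; apply/ltW/riemannR_gt0; lra.
  rewrite /z seriesEnat /= [X in _ -> _ <= _ - X]big_add1 subr_ge0.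
  by under [X in _ -> X <= _]eq_bigr do rewrite div1r.
(* [riemannR] is indexed from [0], so these [K - 1] terms are those of [n = 1, ..., K - 1]. *)
have : series (riemannR s) K.-1 <= zeta s.
  apply: nondecreasing_cvgn_le (cvg_riemannR s1) _.
  by apply: nondecreasing_series => n _ _; apply/ltW/riemannR_gt0; lra.
rewrite seriesEnat /= (@big_cat_nat _ _ _ 5%N)//=; last lia.
rewrite [X in _ -> _ <= _ - X]big_add1 [X in _ -> X <= _ - _]big_add1 /=.
under [X in _ -> _ <= _ - X]eq_bigr do rewrite div1r.
lra.
Qed.

(** * Sum over the cost levels *)

Lemma sum_comp_inj_le (R : realType) (X : finType) (Q : pred X) (h : X -> nat)
    (n : nat) (F : nat -> R) :
  (forall i, 0 <= F i) -> (forall x, Q x -> (h x < n)%N) ->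
  {in Q &, injective h} ->
  \sum_(x | Q x) F (h x) <= \sum_(i < n) F i.
Proof.
move=> F0 hn hinj; case: n hn => [|n] hn.
  by rewrite big_ord0 big1// => x /hn; rewrite ltn0.
pose g x : 'I_n.+1 := inord (h x).
have gE x : Q x -> g x = h x :> nat by move=> Qx; rewrite inordK// hn.
have ginj : {in Q &, injective g}.
  by move=> x y Qx Qy /(congr1 (@nat_of_ord _)); rewrite !gE//; exact: hinj.
rewrite (eq_bigr (fun x => F (g x))); last by move=> x Qx; rewrite gE.
rewrite -(@big_imset _ _ _ _ _ g Q (fun i : 'I_n.+1 => F i))//=.
rewrite [leRHS](bigID (fun i => i \in [set g x | x in Q]%SET)) /=.
by rewrite lerDl sumr_ge0.
Qed.

(** * Cost levels and their representatives *)

Section levels.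
Variables (R : realType) (X : finType) (f : X -> R).

Definition sublevel (x : X) : {set X} := [set y | f y <= f x]%SET.
Definition strict_sublevel (x : X) : {set X} := [set y | f y < f x]%SET.
Definition level (x : X) : {set X} := [set y | f y == f x]%SET.
(** Selects one solution per cost level, so that sums over levels become sums over its fixed
    points. *)
Definition level_repr (x : X) : X := odflt x [pick y | f y == f x].

Lemma level_reprP (x : X) : f (level_repr x) = f x.
Proof. by rewrite /level_repr; case: pickP => [y /eqP//|/(_ x)/=]; rewrite eqxx. Qed.

Lemma eq_level_repr (x y : X) : f x = f y -> level_repr x = level_repr y.
Proof.
move=> fxy; rewrite /level_repr fxy; case: pickP => [//|/(_ x)/=].
by rewrite fxy eqxx.
Qed.

Lemma level_repr_id (x : X) : level_repr (level_repr x) = level_repr x.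
Proof. exact/eq_level_repr/level_reprP. Qed.

Lemma level_repr_inj (x y : X) : level_repr x == x -> level_repr y == y ->
  f x = f y -> x = y.
Proof. by move=> /eqP rx /eqP ry H; rewrite -rx -ry; exact: eq_level_repr. Qed.

Lemma card_sublevel (x : X) :
  #|sublevel x| = (#|level x| + #|strict_sublevel x|)%N.
Proof.
rewrite -cardsUI.
have -> : (level x :|: strict_sublevel x)%SET = sublevel x.
  by apply/setP => y; rewrite !inE le_eqVlt.
have -> : (level x :&: strict_sublevel x)%SET = finset.set0.
  by apply/setP => y; rewrite !inE; case: ltgtP.
by rewrite cards0 addn0.
Qed.

Lemma card_sublevel_gt0 (x : X) : (0 < #|sublevel x|)%N.
Proof. by apply/card_gt0P; exists x; rewrite inE. Qed.

Lemma ltn_card_sublevel (x y : X) : f x < f y -> (#|sublevel x| < #|sublevel y|)%N.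
Proof.
move=> xy; apply: proper_card; apply/properP; split.
  by apply/fintype.subsetP => z; rewrite !inE => /le_trans; apply; exact: ltW.
by exists y; rewrite !inE// -ltNge.
Qed.

Lemma ltn_card_strict_sublevel (x y : X) : f x < f y ->
  (#|strict_sublevel x| < #|strict_sublevel y|)%N.
Proof.
move=> xy; apply: proper_card; apply/properP; split.
  by apply/fintype.subsetP => z; rewrite !inE => /lt_trans; apply.
by exists x; rewrite !inE// ltxx.
Qed.

Definition flat (A : {set X}) : bool := [forall x in A, A \subset level x].

Definition wrong_output (A : {set X}) : bool :=
  [&& A != finset.set0, flat A & A != argmin f].

(** Depends on [A] alone, without a chosen cost value; for nonempty flat [A] it is the sublevel set
    of any member. *)
Definition below (A : {set X}) : {set X} :=
  [set y | [exists x in A, f y <= f x]]%SET.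

Lemma below_sublevel (x : X) (A : {set X}) :
  A != finset.set0 -> A \subset level x -> below A = sublevel x.
Proof.
move=> /finset.set0Pn[z zA] Ax; apply/setP => y; rewrite !inE.
have fA w : w \in A -> f w = f x.
  by move=> /(fintype.subsetP Ax); rewrite inE => /eqP.
apply/idP/idP => [/exists_inP[w wA]|yx]; first by rewrite (fA w).
by apply/exists_inP; exists z => //; rewrite (fA z).
Qed.

(** If cheaper solutions exist, the size of the level is the bound. Otherwise the level is
    [argmin f] and [A] misses one of its elements, hence [maxn 1]. *)
Lemma wrong_output_card (x : X) (A : {set X}) :
  A \subset level x -> A != argmin f ->
  (#|A| <= #|sublevel x| - maxn 1 #|strict_sublevel x|)%N.
Proof.
move=> Ax Am; rewrite card_sublevel.
have cA := subset_leq_card Ax.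
have [U0|U0] := posnP #|strict_sublevel x|; last lia.
rewrite U0 addn0.
suff : (#|A| < #|level x|)%N by lia.
apply: proper_card; rewrite finset.properEneq Ax andbT.
apply: contra Am => /eqP ->; apply/eqP/setP => y; rewrite !inE.
have min_x z : f x <= f z.
  by rewrite leNgt; apply/negP => zx;
    have := cards0_eq U0 => /setP/(_ z); rewrite !inE zx.
apply/eqP/forallP => [-> //|H].
by apply/eqP; rewrite eq_le (min_x y) H.
Qed.

(** * Union bound over the wrong outputs *)

Section union_bound.
Variables (eps kap : R) (t : nat -> nat).
Hypotheses (eps_gt0 : 0 < eps) (alpha_gt12 : 1 / 2 < alpha eps) (kap_ge1 : 1 <= kap).
Hypothesis t_ge : forall m, m%:R * ln (m%:R * kap / eps) <= (t m)%:R.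

Let kap_gt0 : 0 < kap.
Proof. exact: lt_le_trans kap_ge1. Qed.

Let a0 : 0 < alpha eps.
Proof. by apply: lt_trans alpha_gt12; lra. Qed.

Definition set_weight (A : {set X}) : R :=
  (#|A|%:R / #|below A|%:R) ^+ t #|A|.+1.

(** At most [C(N, k)] wrong sets of the level have size [k], so [bin_expr_le] and [level_sum_lt]
    apply. Sizes stop at [K = N - max 1 U], which makes the exponent [N - (K+1)] equal to [U.-1]. *)
Lemma sum_level_weight_le (x : X) :
  \sum_(A : {set X} | [&& A != finset.set0, A \subset level x & A != argmin f])
    set_weight A <=
  eps / kap * ((6 <= #|sublevel x|)%N%:R *
    (4 `^ alpha eps / #|sublevel x|%:R `^ (2 * alpha eps)) / (1 - ratio_lo eps)
  + ratio_hi eps ^+ (#|strict_sublevel x|.-1) / (1 - ratio_hi eps)).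
Proof.
set N := #|sublevel x|; set U := #|strict_sublevel x|.
have N0 : (0 < N)%N := card_sublevel_gt0 x.
pose K := (N - maxn 1 U)%N.
have UN : (U < N)%N.
  rewrite /N card_sublevel -/U -[ltnLHS]add0n ltn_add2r.
  by apply/card_gt0P; exists x; rewrite inE.
have KN : (K < N)%N by rewrite /K; lia.
have := level_sum_lt a0 KN.
have -> : (N - K.+1)%N = U.-1 by rewrite /K; lia.
move=> /ltW /(ler_wpM2l (_ : 0 <= eps / kap)) H.
apply: le_trans (H _); last by apply: divr_ge0; exact: ltW.
rewrite mulr_sumr.
apply: (@le_trans _ _ (\sum_(1 <= k < K.+1)
    'C(N, k)%:R * (k%:R / N%:R) ^+ t k.+1)); last first.
  rewrite big_nat_cond [leRHS]big_nat_cond; apply: ler_sum => k /andP[/andP[k1 kK] _].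
  by apply: bin_expr_le => //; apply/andP; split; lia.
rewrite big_geq_mkord /=.
rewrite (@partition_big _ _ _ _ _ 'I_K.+1 _ (fun A : {set X} => inord #|A|)
    (fun k => 0 < k)%N) /=;
  last first.
  move=> A /and3P[A0 Ax Am]; rewrite inordK ?ltnS ?wrong_output_card//.
  by rewrite card_gt0.
apply: ler_sum => k k0.
apply: (@le_trans _ _ (\sum_(A in
    [set A : {set X} | (A \subset level x) & (#|A| == k)]%SET)
    (k%:R / N%:R) ^+ t k.+1)); last first.
  rewrite sumr_const cards_draws -[leLHS]mulr_natl.
  apply: ler_wpM2r; first by rewrite exprn_ge0// divr_ge0.
  by rewrite ler_nat; apply: leq_bin2l; rewrite /N card_sublevel leq_addr.
(* Sets of size [k] that are not wrong only enlarge the right side. *)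
rewrite [leRHS](bigID (fun A => (A != finset.set0) && (A != argmin f))) /=.
rewrite -[leLHS]addr0; apply: lerD; last first.
  by apply: sumr_ge0 => A _; rewrite exprn_ge0// divr_ge0.
rewrite le_eqVlt; apply/orP; left; apply/eqP; apply: eq_big => A; last first.
  move=> /andP[/and3P[A0 Ax Am] /eqP <-].
  by rewrite /set_weight (below_sublevel A0 Ax) inordK// ltnS wrong_output_card.
rewrite !inE.
case A0 : (A != _); rewrite ?andbF//=; case Ax : (A \subset _); rewrite ?andbF//=.
case Am : (A != _); rewrite ?andbF//= andbT.
by rewrite -val_eqE /= inordK// ltnS wrong_output_card.
Qed.

(** Each wrong [A] is charged to the representative of its level. *)
Lemma sum_wrong_weight_le :
  \sum_(A | wrong_output A) set_weight A <=
  \sum_(x | level_repr x == x)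
   \sum_(A : {set X} | [&& A != finset.set0, A \subset level x & A != argmin f])
    set_weight A.
Proof.
have w0 A : 0 <= set_weight A by rewrite exprn_ge0// divr_ge0.
rewrite (exchange_big_dep predT)//= big_mkcond; apply: ler_sum => A _.
case: ifP => [/and3P[A0 fA Am]|_]; last exact: sumr_ge0.
have /finset.set0Pn[z zA] := A0.
pose x := level_repr z.
have Ax : A \subset level x.
  have /forall_inP/(_ z zA) := fA.
  by rewrite /level level_reprP.
rewrite (bigD1 x) /=; last by rewrite level_repr_id eqxx A0 Ax Am.
by rewrite lerDl sumr_ge0.
Qed.

Lemma sum_wrong_weight_lt :
  \sum_(A | wrong_output A) set_weight A < eps / kap * kappa2 eps.
Proof.
have /andP[q0 q1] := ratio_lo_lt1 a0; have /andP[r0 r1] := ratio_hi_lt1 a0.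
apply: le_lt_trans sum_wrong_weight_le _.
apply: le_lt_trans (ler_sum _ (fun x _ => sum_level_weight_le x)) _.
rewrite -mulr_sumr ltr_pM2l ?divr_gt0//.
rewrite big_split /= -!mulr_suml.
(* A count strictly increasing in the cost separates the levels, so sums over levels are dominated
   by sums over integers. *)
have inj h : (forall x y, f x < f y -> (h x < h y)%N) ->
    {in [pred x | level_repr x == x] &, injective h}.
  move=> hmono x y; rewrite !inE => rx ry hxy; apply: level_repr_inj => //.
  by case: (ltgtP (f x) (f y)) => // /hmono; rewrite hxy ltnn.
pose F n : R := (6 <= n)%N%:R * (4 `^ alpha eps / n%:R `^ (2 * alpha eps)).
have lo : \sum_(x | level_repr x == x) F #|sublevel x| <=
    4 `^ alpha eps * (zeta (2 * alpha eps) -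
      \sum_(1 <= k < 6) 1 / (k%:R `^ (2 * alpha eps))).
  apply: le_trans (@sum_comp_inj_le _ _ [pred x | level_repr x == x]
    (fun x => #|sublevel x|) #|X|.+1 F _ _ _) _.
  - by move=> i; rewrite /F !mulr_ge0 ?invr_ge0 ?powR_ge0.
  - by move=> x _; rewrite ltnS max_card.
  - by apply: inj => x y; exact: ltn_card_sublevel.
  apply: le_trans (ler_wpM2l (powR_ge0 _ _)
    (@zeta_tail_ge R (2 * alpha eps) #|X|.+1 _)); last first.
    by have := alpha_gt12; lra.
  rewrite big_geq_mkord /= mulr_sumr [leRHS]big_mkcond /=; apply: ler_sum => i _.
  by rewrite /F; case: ifP; rewrite ?mul0r ?mul1r.
(* The extra [1] is there because the truncated predecessor gives exponent [0] for both counts [0]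
   and [1]. *)
have hi : \sum_(x | level_repr x == x) ratio_hi eps ^+ #|strict_sublevel x|.-1 <
    1 + (1 - ratio_hi eps)^-1.
  apply: le_lt_trans (@sum_comp_inj_le _ _ [pred x | level_repr x == x]
    (fun x => #|strict_sublevel x|) #|X|.+1 (fun n => ratio_hi eps ^+ n.-1) _ _ _) _.
  - by move=> i; rewrite exprn_ge0// ltW.
  - by move=> x _; rewrite ltnS max_card.
  - by apply: inj => x y; exact: ltn_card_strict_sublevel.
  rewrite big_ord_recl /= expr0 ltrD2l.
  by apply: geometric_sum_lt; rewrite r0 r1.
rewrite /kappa2 -/(ratio_lo eps) -/(ratio_hi eps).
have -> : (2 - ratio_hi eps) / (1 - ratio_hi eps) ^+ 2 =
    (1 + (1 - ratio_hi eps)^-1) / (1 - ratio_hi eps).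
  by field; lra.
rewrite mulrAC; apply: ler_ltD.
  by rewrite ler_pM2r// invr_gt0; lra.
by rewrite ltr_pM2r// invr_gt0; lra.
Qed.

End union_bound.
End levels.

(** The second summand suffices, as [2 - r >= (1 - r) ^ 2]; the zeta tail is nonnegative. *)
Lemma kappa2_ge1 (R : realType) (eps : R) : 1 / 2 < alpha eps -> 1 <= kappa2 eps.
Proof.
move=> a12; have a0 : 0 < alpha eps by lra.
have /andP[q0 q1] := ratio_lo_lt1 a0; have /andP[r0 r1] := ratio_hi_lt1 a0.
rewrite /kappa2 -/(ratio_lo eps) -/(ratio_hi eps) -[leLHS]add0r lerD//.
  rewrite mulr_ge0// ?divr_ge0 ?powR_ge0//; first lra.
  by have := @zeta_tail_ge R (2 * alpha eps) 0; rewrite big_geq//; apply; lra.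
by rewrite ler_pdivlMr ?exprn_gt0 ?subr_gt0//; nra.
Qed.

(** * Words of independent samples *)

Section words.
Variables (R : realType) (X : finType) (p : X -> R).
Hypothesis p_distr : prob_distribution p.

(** Expectation over [n] independent letters of law [p], as an iterated finite sum: the estimates
    below become inductions on the first letter. *)
Fixpoint word_mean (n : nat) (g : seq X -> R) : R :=
  if n is n'.+1 then \sum_(x : X) p x * word_mean n' (fun w => g (x :: w))
  else g [::].

Let p0 x : 0 <= p x.
Proof. by case: p_distr. Qed.

Lemma le_word_mean (n : nat) (g h : seq X -> R) :
  (forall w, g w <= h w) -> word_mean n g <= word_mean n h.
Proof.
elim: n g h => [|n IH] g h gh //=.
by apply: ler_sum => x _; apply: ler_wpM2l => //; exact: IH.
Qed.

Lemma eq_word_mean (n : nat) (g h : seq X -> R) :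
  g =1 h -> word_mean n g = word_mean n h.
Proof. by move=> gh; apply/eqP; rewrite eq_le !le_word_mean// => w; rewrite gh. Qed.

Lemma word_meanD (n : nat) (g h : seq X -> R) :
  word_mean n (fun w => g w + h w) = word_mean n g + word_mean n h.
Proof.
elim: n g h => [|n IH] g h //=.
by rewrite -big_split; apply: eq_bigr => x _; rewrite IH mulrDr.
Qed.

Lemma word_mean_cst (n : nat) (c : R) : word_mean n (fun=> c) = c.
Proof.
elim: n => [|n IH] //=.
by under eq_bigr do rewrite IH; rewrite -mulr_suml (proj2 p_distr) mul1r.
Qed.

Lemma word_mean_sum (n : nat) (I : Type) (s : seq I) (Q : pred I) (g : I -> seq X -> R) :
  word_mean n (fun w => \sum_(i <- s | Q i) g i w) =
  \sum_(i <- s | Q i) word_mean n (g i).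
Proof.
elim: s => [|i s IH].
  rewrite big_nil -[RHS](word_mean_cst n); apply: eq_word_mean => w.
  by rewrite big_nil.
rewrite big_cons -IH; case: ifP => Qi; last first.
  by apply: eq_word_mean => w; rewrite big_cons Qi.
by rewrite -word_meanD; apply: eq_word_mean => w; rewrite big_cons Qi.
Qed.

Definition weight (A : {set X}) : R := \sum_(x in A) p x.

(** The word must contain at least [t] letters of [B], the first [t] of them in [A]; a word with too
    few hits gives [false]. *)
Fixpoint first_hits_in (B A : {set X}) (t : nat) (w : seq X) : bool :=
  match t, w with
  | 0, _ => true
  | _.+1, [::] => false
  | t'.+1, x :: w' =>
      if x \in B then (x \in A) && first_hits_in B A t' w'
      else first_hits_in B A t w'
  end.

Lemma first_hits_in_cat (B A : {set X}) (t : nat) (u v : seq X) :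
  all (fun x => (x \in B) ==> (x \in A)) u -> (t <= count (mem B) u)%N ->
  first_hits_in B A t (u ++ v).
Proof.
elim: u t => [|x u IH] [|t] //=; first by case: v.
move=> /andP[]; case: (x \in B) => //= xA uA tu.
  by rewrite xA IH.
exact: IH.
Qed.

Lemma sum_weight_split (B : {set X}) (b c : R) :
  \sum_(x : X) p x * (if x \in B then b else c) =
  weight B * b + (1 - weight B) * c.
Proof.
have E : \sum_(x | x \notin B) p x = 1 - weight B.
  by rewrite -(proj2 p_distr) [X in _ = X - _](bigID (mem B)) /= addrAC subrr add0r.
rewrite (bigID (mem B)) /= /weight !mulr_suml -E mulr_suml.
by congr (_ + _); apply: eq_bigr => x; [move=> ->|move=> /negbTE ->].
Qed.

Lemma weight_le1 (B : {set X}) : weight B <= 1.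
Proof.
by rewrite -(proj2 p_distr) [leRHS](bigID (mem B)) /= lerDl sumr_ge0.
Qed.

Lemma weight_ge0 (B : {set X}) : 0 <= weight B.
Proof. exact: sumr_ge0. Qed.

(** Condition on the first letter: in [A] it lowers [t], in the rest of [B] it fails, elsewhere it
    changes nothing. The powers of [q] solve this recursion exactly because
    [weight A = q * weight B]. *)
Lemma word_mean_first_hits (B A : {set X}) (t n : nat) :
  A \subset B -> 0 < weight B ->
  word_mean n (fun w => (first_hits_in B A t w)%:R) <= (weight A / weight B) ^+ t.
Proof.
move=> AB wB; have q0 : 0 <= weight A / weight B.
  by apply: divr_ge0; exact: weight_ge0.
elim: n t => [|n IH] [|t] //=; rewrite ?expr0 ?exprn_ge0//.
  under eq_bigr do rewrite (@eq_word_mean _ _ (fun=> 1))// word_mean_cst mulr1.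
  by rewrite (proj2 p_distr).
set q := _ / _.
apply: (@le_trans _ _ (\sum_x p x * (if x \in A then q ^+ t
    else if x \in B then 0 else q ^+ t.+1))).
  apply: ler_sum => x _; apply: ler_wpM2l => //.
  have [xA|xA] := ifPn.
    by rewrite (fintype.subsetP AB x xA) /=; exact: IH.
  have [xB|xB] := ifPn; last by apply: IH.
  by rewrite word_mean_cst.
have -> : \sum_x p x * (if x \in A then q ^+ t else if x \in B then 0 else q ^+ t.+1) =
    weight A * q ^+ t + (1 - weight B) * q ^+ t.+1.
  have <- : \sum_x p x * (if x \in A then q ^+ t else 0) +
            \sum_x p x * (if x \in B then 0 else q ^+ t.+1) =
            weight A * q ^+ t + (1 - weight B) * q ^+ t.+1.
    by rewrite !sum_weight_split; ring.
  rewrite -big_split; apply: eq_bigr => x _ /=; rewrite -mulrDr; congr (_ * _).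
  case: ifPn => [xA|_]; last by rewrite add0r.
  by rewrite (fintype.subsetP AB x xA) addr0.
have -> : weight A = q * weight B by rewrite /q mulfVK// gt_eqF.
by rewrite exprS le_eqVlt; apply/orP; left; apply/eqP; ring.
Qed.

(** Markov's inequality for [2 ^ (t - count)], whose mean is the right side, carried out letter by
    letter. *)
Lemma word_mean_few_hits (B : {set X}) (t n : nat) :
  word_mean n (fun w => (count (mem B) w < t)%N%:R) <=
  2 ^+ t * (1 - weight B / 2) ^+ n.
Proof.
have w0 := weight_ge0 B; have w1 := weight_le1 B.
have r0 : 0 <= 1 - weight B / 2 by lra.
elim: n t => [|n IH] [|t] //=; rewrite ?mulr_ge0 ?exprn_ge0//.
- by rewrite expr0 mulr1; case: (_ < _)%N => //; rewrite exprn_ege1// ler1n.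
- rewrite big1 ?mulr_ge0 ?exprn_ge0// => x _.
  by rewrite (@eq_word_mean _ _ (fun=> 0))// word_mean_cst mulr0.
set r := 1 - _.
apply: (@le_trans _ _ (\sum_x p x * (if x \in B then 2 ^+ t * r ^+ n
    else 2 ^+ t.+1 * r ^+ n))).
  apply: ler_sum => x _; apply: ler_wpM2l => //.
  by case: ifPn => xB; exact: IH.
rewrite sum_weight_split /r !exprS le_eqVlt; apply/orP; left; apply/eqP.
by field.
Qed.

End words.

(** * Law of the first samples *)

Section sampling.
Variables (R : realType) (d : measure_display) (T : measurableType d).
Variables (P : probability T R) (X : finType) (Y : nat -> T -> X) (p : X -> R).
Hypotheses (p_distr : prob_distribution p) (Y_samples : independent_samples P Y p).

Definition prefix_of (n : nat) (w : T) : seq X := mkseq (fun i => Y i w) n.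

Lemma measurable_prefix_of (n : nat) (Q : pred (seq X)) :
  measurable [set w | Q (prefix_of n w)].
Proof.
case: Y_samples => mY _ _; elim: n Q => [|n IH] Q.
  case q : (Q [::]).
    by rewrite (_ : [set _ | _] = setT) //; apply/seteqP; split.
  by rewrite (_ : [set _ | _] = set0) //; apply/seteqP; split => // w; rewrite /= q.
have -> : [set w | Q (prefix_of n.+1 w)] =
    \bigcup_(x in [set: X]) ([set w | Q (rcons (prefix_of n w) x)] `&` Y n @^-1` [set x]).
  apply/seteqP; split => [w /= Qw|w [x _ [/= Qw xE]]];
    last by rewrite /= /prefix_of mkseqS [Y n w]xE.
  by exists (Y n w) => //; split => //=; move: Qw; rewrite /prefix_of mkseqS.
apply: fin_bigcup_measurable => [|x _]; first exact: finite_finset.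
apply: measurableI; last exact: mY.
exact: (IH (fun v => Q (rcons v x))).
Qed.

Lemma measure_fiber_sum (n : nat) (S : set T) : measurable S ->
  P S = (\sum_(x : X) P (S `&` Y n @^-1` [set x]))%E.
Proof.
move=> mS; case: Y_samples => mY _ _.
have E : S = \bigcup_(x in [set: X]) (S `&` Y n @^-1` [set x]).
  apply/seteqP; split => [w Sw|w [x _ []]//].
  by exists (Y n w).
rewrite {1}E measure_fin_bigcup.
- rewrite (fsbigTE [fset x | x in X]%fset); last by move=> x; rewrite !inE.
  apply: perm_big; apply: uniq_perm; rewrite ?fset_uniq ?index_enum_uniq//.
  by move=> x; rewrite !inE mem_index_enum.
- exact: finite_finset.
- by move=> x y _ _ [w [[_ /= <-] [_ /= <-]]].
- by move=> x _; apply: measurableI => //; exact: mY.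
Qed.

Lemma prob_cylinder (v : seq X) :
  P [set w | prefix_of (size v) w = v] = (\prod_(x <- v) p x)%:E.
Proof.
case: Y_samples => mY pY indep.
case: v => [|x0 v'].
  by rewrite big_nil -(@probability_setT _ _ _ P); congr (P _); apply/seteqP; split.
set v := x0 :: v'; pose J := [fset i in iota 0 (size v)]%fset.
have memJ i : (i \in J) = (i < size v)%N by rewrite /J in_fset [LHS]mem_iota.
have -> : [set w | prefix_of (size v) w = v] =
    \bigcap_(j in [set` J]) (Y j @^-1` [set nth x0 v j]).
  apply/seteqP; split => w /=.
    move=> wv j /=; rewrite memJ => jv /=.
    by rewrite -wv nth_mkseq// size_mkseq.
  move=> H; apply: (@eq_from_nth _ x0); rewrite size_mkseq// => i iv.
  by rewrite nth_mkseq//; apply: (H i); rewrite /= memJ.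
rewrite indep (eq_bigr (fun j => (p (nth x0 v j))%:E)); last by move=> j _; exact: pY.
rewrite prodEFin; congr (_%:E); rewrite [RHS](big_nth x0) /index_iota subn0.
apply: perm_big; apply: uniq_perm; rewrite ?fset_uniq ?iota_uniq//.
by move=> i; rewrite memJ mem_iota.
Qed.

(** The fixed prefix [v] is what the induction needs: each letter that [word_mean] peels off is
    appended to [v]. *)
Lemma prob_prefix_cylinder (n : nat) (v : seq X) (Q : pred (seq X)) :
  P ([set w | prefix_of (size v) w = v] `&` [set w | Q (prefix_of (size v + n) w)]) =
  (\prod_(x <- v) p x * word_mean p n (fun w => (Q (v ++ w))%:R))%:E.
Proof.
elim: n v => [|n IH] v.
  rewrite /= cats0 addn0; case q : (Q v).
    rewrite mulr1 -prob_cylinder; congr (P _); apply/seteqP; split => w /=; first by case.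
    by move=> wv; split => //; rewrite wv.
  rewrite mulr0 (_ : _ `&` _ = set0) ?measure0//.
  by apply/seteqP; split => // w /= [->]; rewrite q.
rewrite (measure_fiber_sum (size v)); last first.
  apply: measurableI; last exact: measurable_prefix_of.
  have -> : [set w | prefix_of (size v) w = v] =
      [set w | pred1 v (prefix_of (size v) w)].
    by apply/seteqP; split => w /= /eqP.
  exact: measurable_prefix_of.
rewrite /= mulr_sumr -sumEFin; apply: eq_bigr => x _.
have := IH (rcons v x); rewrite -cats1 big_cat big_seq1 /= -mulrA.
rewrite size_cat /= [(_ + 1 + n)%N]addnAC -addnA !addn1 => E.
rewrite [X in _ = (_ * (_ * X))%:E](@eq_word_mean _ _ _ p_distr n _
    (fun w => (Q ((v ++ [:: x]) ++ w))%:R)); last first.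
  by move=> w; rewrite -catA.
rewrite -E; congr (P _); apply/seteqP; split => w /=.
  move=> [[wv Qw] xw]; split => //.
  by rewrite /prefix_of mkseqS -/(prefix_of _ w) wv xw cats1.
rewrite {1}/prefix_of mkseqS -/(prefix_of _ w) cats1 => -[/eqP].
by rewrite eqseq_rcons => /andP[/eqP wv /eqP xw] Qw.
Qed.

Lemma prob_prefix (n : nat) (Q : pred (seq X)) :
  P [set w | Q (prefix_of n w)] = (word_mean p n (fun w => (Q w)%:R))%:E.
Proof.
have := prob_prefix_cylinder n [::] Q; rewrite /= big_nil mul1r => <-.
by congr (P _); apply/seteqP; split => w //= [].
Qed.

End sampling.

(** * Runs of the algorithm *)

Section algorithm.
Variables (R : realType) (X : finType) (f : X -> R) (eps : R).

(* Clipping at 0 makes [quotaE] hold without a sign condition on the threshold. *)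
Definition quota (m : nat) : nat := absz (Num.max 0 (threshold eps m)).

Lemma quotaE (m tau : nat) : (threshold eps m <= tau%:Z) = (quota m <= tau)%N.
Proof.
rewrite /quota -lez_nat gez0_abs; last by rewrite le_max lexx.
by rewrite ge_max.
Qed.

Lemma quota_ge (m : nat) : m%:R * ln (m%:R * kappa2 eps / eps) <= (quota m)%:R.
Proof.
apply: le_trans (ceil_ge _) _.
rewrite /quota -[(absz _)%:R]/((absz _)%:Z%:~R) gez0_abs; last by rewrite le_max lexx.
by rewrite ler_int le_max lexx orbT.
Qed.

(** [tau] counts repetitions, [A] does not. At a halt [#|A| < m], so [inv_m] then forces
    [m = #|A|.+1]. *)
Record running_inv (s : nat -> X) (theta : R) (A : {set X}) (tau m n : nat) : Prop := {
  inv_min : forall i, (i < n)%N -> theta <= f (s i);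
  inv_set : forall x, (x \in A) = (f x == theta) && (x \in mkseq s n);
  inv_tau : tau = count (fun x => f x == theta) (mkseq s n);
  inv_m : (2 <= m <= #|A|.+1)%N }.

(* [n * #|X|.+2 + m] grows with every transition since [m <= #|X|.+1]. *)
Definition config_inv (s : nat -> X) (n0 k : nat) (c : config R X) : Prop :=
  match c with
  | Running theta A tau m n =>
      [/\ running_inv s theta A tau m n, (n <= n0)%N
        & (k <= n * #|X|.+2 + m)%N]
  | Returned A =>
      exists theta tau m n, [/\ running_inv s theta A tau m n, (n <= n0)%N,
        (#|A| < m)%N & (quota m <= tau)%N]
  end.

Variables (s : nat -> X) (n0 T : nat).
Hypothesis quota_le : forall m, (m <= #|X|.+1)%N -> (quota m <= T)%N.
Hypothesis many_hits : (T <= count (mem (argmin f)) (mkseq s n0))%N.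

Lemma mem_prefix (n : nat) (x : X) :
  reflect (exists2 i, (i < n)%N & s i = x) (x \in mkseq s n).
Proof.
apply: (iffP mapP) => [[i]|[i iN <-]].
  by rewrite mem_iota => iN ->; exists i.
by exists i => //; rewrite mem_iota.
Qed.

(** Once a minimizer has been drawn, [theta] is the minimum and [tau] counts the minimizers drawn,
    of which there are at least [T]. *)
Lemma quota_reached (theta : R) (A : {set X}) (tau m : nat) :
  running_inv s theta A tau m n0 -> (quota m <= tau)%N.
Proof.
move=> [imin iset itau /andP[m2 mA]].
have mX : (m <= #|X|.+1)%N by apply: leq_trans mA _; rewrite ltnS max_card.
have qT := quota_le mX.
(* With [T = 0] no minimizer need have been drawn, but then the quota is [0]. *)
have [T0|T0] := posnP T; first by move: qT; rewrite T0 leqn0 => /eqP ->.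
have /hasP[a /mem_prefix[i iN sia] amin] : has (mem (argmin f)) (mkseq s n0).
  by rewrite has_count (leq_trans T0).
have /card_gt0P[x] : (0 < #|A|)%N by lia.
rewrite iset => /andP[/eqP fx _].
have minE y : (y \in argmin f) = (f y == theta).
  move: amin; rewrite /= !inE => /forallP amin.
  have fa : f a = theta.
    by apply/eqP; rewrite eq_le -{1}fx amin -sia imin.
  apply/forallP/eqP => [H|-> z]; last by rewrite -fa.
  by apply/eqP; rewrite eq_le -{1}fa H -fa amin.
rewrite itau; apply: leq_trans qT (leq_trans many_hits _).
by rewrite leq_eqVlt; apply/orP; left; apply/eqP; apply: eq_count.
Qed.

Lemma running_step_inv (theta : R) (A : {set X}) (tau m n : nat) (y := s n) :
  running_inv s theta A tau m n ->
  if theta < f y then running_inv s theta A tau m n.+1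
  else if f y == theta then running_inv s theta (y |: A)%SET tau.+1 m n.+1
  else running_inv s (f y) [set y]%SET 1 2 n.+1.
Proof.
move=> [imin iset itau /andP[m2 mA]].
case: ltgtP => [ty|yt|ty].
- split.
  + by move=> i; rewrite ltnS leq_eqVlt => /predU1P[->|/imin//]; exact: ltW.
  + move=> x; rewrite iset mkseqS mem_rcons in_cons; case: eqP => //= fx.
        by case: eqP => // xy; move: ty; rewrite /y -xy fx ltxx.
  + by rewrite mkseqS -cats1 count_cat /= -/y gt_eqF// !addn0.
  + by rewrite m2.
- have far x : x \in mkseq s n -> f y < f x.
    by move=> /mem_prefix[i /imin iN <-]; exact: lt_le_trans iN.
  split.
  + move=> i; rewrite ltnS leq_eqVlt => /predU1P[->|/imin]//.
    by move=> /(lt_le_trans yt)/ltW.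
  + move=> x; rewrite finset.in_set1 mkseqS mem_rcons in_cons -/y.
    have [->|xy] /= := eqVneq x y; first by rewrite eqxx.
    case xn : (x \in mkseq s n); rewrite ?andbF// andbT.
    by rewrite gt_eqF// far.
  + rewrite mkseqS -cats1 count_cat /= -/y eqxx addn0.
    rewrite (@eq_in_count _ _ pred0) ?count_pred0//.
    by move=> x /far; rewrite lt_neqAle eq_sym => /andP[/negbTE].
  + by rewrite cards1.
- split.
  + by move=> i; rewrite ltnS leq_eqVlt => /predU1P[->|/imin//]; rewrite -/y -ty.
  + move=> x; rewrite finset.in_setU1 iset mkseqS mem_rcons in_cons -/y.
    have [->|xy] //= := eqVneq x y; first by rewrite -ty eqxx.
  + by rewrite mkseqS -cats1 count_cat /= -/y -ty eqxx itau addn1.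
  + rewrite m2 /=; apply: leq_trans mA _; rewrite ltnS.
    exact/subset_leq_card/finset.subsetUr.
Qed.

Lemma config_inv_step (k : nat) (c : config R X) :
  config_inv s n0 k c -> config_inv s n0 k.+1 (step f eps s c).
Proof.
case: c => [theta A tau m n|A] //= [inv nn0 kpot]; rewrite quotaE.
have /andP[m2 mA] := inv_m inv.
have mX : (m <= #|X|.+1)%N by apply: leq_trans mA _; rewrite ltnS max_card.
case: ifPn => [tm|tm].
  case: ifPn => [Am|Am]; first by exists theta, tau, m, n.
  split => //; last by rewrite addnS ltnS.
  case: inv => imin iset itau im; split => //.
  by apply/andP; split; lia.
(* At [n = n0] the test passes by [quota_reached], so every draw happens earlier. *)
have {}nn0 : (n < n0)%N.
  rewrite ltn_neqAle nn0 andbT; apply: contra tm => /eqP nE.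
  by apply: quota_reached; rewrite -nE; exact: inv.
have := running_step_inv inv.
(* Even when [m] falls back to [2], the gain [#|X|.+2] of a draw outweighs the loss. *)
have pot : (k < n.+1 * #|X|.+2 + 2)%N.
  by rewrite mulSn; move: (n * #|X|.+2)%N kpot mX => a; lia.
case: ifP => _; [|case: ifP => _]; split => //;
  rewrite mulSn; move: (n * #|X|.+2)%N kpot mX => a; lia.
Qed.

(** [K] exceeds the potential of every running configuration with [n <= n0], so none is left after
    [K] steps. *)
Lemma eventually_returned : (0 < n0)%N ->
  exists2 A, returns f eps s A & config_inv s n0 0 (Returned R A).
Proof.
move=> n00; pose K := (n0 * #|X|.+2 + #|X|.+2)%N.
have : config_inv s n0 K (iter K (step f eps s) (start f s)).
  move: K => K; elim: K => [|K IH]; last by rewrite iterS; exact: config_inv_step.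
  rewrite /= /start; split => //; split => //.
  - by case.
  - by move=> x; rewrite finset.in_set1 in_cons orbF; case: eqP => [->|]; rewrite ?eqxx ?andbF.
  - by rewrite /= eqxx.
  - by rewrite cards1.
case E : (iter _ _ _) => [theta A tau m n|A] /=; last by exists A => //; exists K.
move=> [inv nn0]; have /andP[m2 mA] := inv_m inv.
have mX : (m <= #|X|.+1)%N by apply: leq_trans mA _; rewrite ltnS max_card.
have : (n * #|X|.+2 <= n0 * #|X|.+2)%N by rewrite leq_mul2r nn0 orbT.
rewrite /K => le_n le_K; exfalso.
by move: (n * #|X|.+2)%N (n0 * #|X|.+2)%N mX le_n le_K => a b; lia.
Qed.

(** Up to the halt, every sample of cost at most [theta] lies in [A], and there are at least
    [quota m] of them; samples after the halt cannot affect these first hits. *)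
Lemma returned_argmin_or_wrong : (0 < n0)%N ->
  returns f eps s (argmin f) \/
  exists2 A, wrong_output f A &
    first_hits_in (below f A) A (quota #|A|.+1) (mkseq s n0).
Proof.
move=> n00; have [A retA [theta [tau [m [n [[imin iset itau /andP[m2 mA]] nn0 Am qm]]]]]] :=
  eventually_returned n00.
have [<-|Aargmin] := eqVneq A (argmin f); [by left|right].
have fA x : x \in A -> f x = theta by rewrite iset => /andP[/eqP].
have A0 : A != finset.set0 by rewrite -card_gt0; lia.
have /finset.set0Pn[a aA] := A0.
have bE x : (x \in below f A) = (f x <= theta).
  rewrite inE; apply/exists_inP/idP => [[z /fA ->]//|fx].
  by exists a => //; rewrite (fA a).
exists A.
  rewrite /wrong_output A0 Aargmin andbT /=; apply/forall_inP => x xA.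
  by apply/fintype.subsetP => z zA; rewrite inE (fA x)// (fA z).
have -> : mkseq s n0 = mkseq s n ++ map s (iota n (n0 - n)).
  by rewrite /mkseq -map_cat -{2}[n]add0n -iotaD subnKC.
have mE : m = #|A|.+1 by lia.
rewrite -mE; apply: first_hits_in_cat.
  apply/allP => x xn; rewrite bE iset xn andbT eq_le.
  by have /mem_prefix[i /imin ti <-] := xn; rewrite ti andbT implybb.
apply: leq_trans qm _; rewrite itau; apply: sub_count => x /= /eqP fx.
by rewrite bE fx.
Qed.

End algorithm.

(** After [k] steps at most [k+1] samples have been drawn; this makes [returns] a measurable
    event. *)
Lemma iter_step_prefix (R : realType) (X : finType) (f : X -> R) (eps : R)
    (s s' : nat -> X) (k : nat) :
  (forall i, (i <= k)%N -> s i = s' i) ->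
  iter k (step f eps s) (start f s) = iter k (step f eps s') (start f s').
Proof.
move=> ss'.
suff [] : iter k (step f eps s) (start f s) = iter k (step f eps s') (start f s') /\
    if iter k (step f eps s) (start f s) is Running _ _ _ _ n then (n <= k.+1)%N else true by [].
elim: k ss' => [|k IH] ss' /=; first by rewrite /start ss'.
have [<- ] := IH (fun i ik => ss' i (leqW ik)).
case: (iter _ _ _) => [theta A tau m n|A] //= nk; rewrite -ss'//.
by split => //; do 4?[case: ifP => // _]; rewrite leqW.
Qed.

(** * Success probability *)

Lemma alpha_gt_half (R : realType) (eps : R) : 0 < eps ->
  eps < 1 / expR (3 / 2) -> 1 / 2 < alpha eps.
Proof.
move=> eps_gt0 eps_lt.
have : 3 / 2 < ln (1 / eps).
  rewrite -[ltLHS]expRK ltr_ln ?posrE ?expR_gt0 ?divr_gt0//.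
  by rewrite div1r -ltf_pV2 ?posrE ?expR_gt0 ?invr_gt0// invrK -div1r.
by rewrite /alpha; lra.
Qed.

Section fair.
Variables (R : realType) (X : finType) (f p : X -> R).
Hypotheses (p_distr : prob_distribution p) (p_fair : cost_ordered_fair f p).

Lemma fair_le (x y : X) : f x <= f y -> p y <= p x.
Proof.
have [lt_xy eq_xy] := p_fair x y; rewrite le_eqVlt => /predU1P[/eq_xy ->//|].
exact: lt_xy.
Qed.

(** By fairness a minimizer has maximal probability; if it were [0], all probabilities would
    vanish. *)
Lemma weight_argmin_gt0 : (0 < #|X|)%N -> 0 < weight p (argmin f).
Proof.
move=> /card_gt0P[x0 _]; have [p0 p1] := p_distr.
have [a _ amin] := Order.TotalTheory.arg_minP f (isT : predT x0).
have ain : a \in argmin f by rewrite inE; apply/forallP => y; exact: amin.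
rewrite /weight (bigD1 a)//= ltr_wpDr ?sumr_ge0// lt_neqAle p0 andbT eq_sym.
apply/negP => /eqP pa; move: p1; rewrite big1 => [/eqP|x _].
  by rewrite eq_sym oner_eq0.
by apply/eqP; rewrite eq_le p0 andbT -pa fair_le// amin.
Qed.

Lemma argmin_sub_below (A : {set X}) : A != finset.set0 -> argmin f \subset below f A.
Proof.
move=> /finset.set0Pn[a aA]; apply/fintype.subsetP => x.
rewrite !inE => /forallP xmin; apply/exists_inP.
by exists a.
Qed.

Lemma weight_subset (A B : {set X}) : A \subset B -> weight p A <= weight p B.
Proof.
move=> AB; have [p0 _] := p_distr.
rewrite /weight [leRHS](big_setID A) /= (finset.setIidPr AB).
by rewrite lerDl sumr_ge0.
Qed.

(** By fairness [p] is constant on [A] and at least as large on all of [below f A]. *)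
Lemma wrong_ratio_le (A : {set X}) : A != finset.set0 -> flat f A ->
  0 < weight p (below f A) ->
  weight p A / weight p (below f A) <= #|A|%:R / #|below f A|%:R.
Proof.
move=> A0 /forall_inP fA wB; have /finset.set0Pn[a aA] := A0.
have Aa : A \subset level f a := fA a aA.
have BE := below_sublevel A0 Aa.
have B0 : 0 < #|below f A|%:R :> R by rewrite ltr0n BE card_sublevel_gt0.
have wA : weight p A = #|A|%:R * p a.
  rewrite /weight (eq_bigr (fun=> p a)) ?sumr_const ?mulr_natl// => x xA.
  apply: (proj2 (p_fair x a)); have := fintype.subsetP Aa x xA.
  by rewrite inE => /eqP.
have wBge : #|below f A|%:R * p a <= weight p (below f A).
  rewrite /weight mulr_natl -sumr_const; apply: ler_sum => y.
  by rewrite BE inE; exact: fair_le.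
rewrite ler_pdivrMr// mulrAC ler_pdivlMr// wA -mulrA.
by apply: ler_wpM2l => //; rewrite mulrC.
Qed.

End fair.

Lemma complement_lt (R : realType) (good bad few bad' few' e : R) :
  1 <= good + bad + few -> bad <= bad' -> few <= few' -> few' < e - bad' ->
  1 - e < good.
Proof. by lra. Qed.

Unset Implicit Arguments.

Theorem theorem2 (R : realType) (X : finType) (X_nonempty : (0 < #|X|)%N)
    (f : X -> R) (eps : R) (eps_gt0 : 0 < eps)
    (eps_lt : eps < 1 / expR (3 / 2))
    (p : X -> R) (p_distr : prob_distribution p)
    (p_fair : cost_ordered_fair f p)
    (d : measure_display) (T : measurableType d) (P : probability T R)
    (Y : nat -> T -> X) (Y_samples : independent_samples P Y p) :
  let success := [set w : T | returns f eps (fun n => Y n w) (argmin f)] in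
  measurable success /\ ((1 - eps)%:E < P success)%E.
Proof.
move=> success.
have a12 := alpha_gt_half eps_gt0 eps_lt.
have kap1 := kappa2_ge1 a12.
have kap0 : 0 < kappa2 eps by exact: lt_le_trans kap1.
have msuccess : measurable success.
  (* Quantifying over streams that extend the prefix turns a halt within [k] steps into a predicate
     on words. *)
  have -> : success = \bigcup_k [set w | `[< exists2 s : nat -> X,
      mkseq s k.+1 = prefix_of Y k.+1 w &
      iter k (step f eps s) (start f s) = Returned R (argmin f) >]].
    apply/seteqP; split => [w [k kret]|w [k _ /asboolP[s sw sret]]].
      by exists k => //; apply/asboolP; exists (fun n => Y n w).
    exists k; rewrite -sret; apply: iter_step_prefix => i ik.
    have := congr1 (fun v => nth (s 0%N) v i) sw.
    by rewrite /prefix_of !nth_mkseq.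
  apply: bigcup_measurable => k _.
  exact: (measurable_prefix_of Y_samples k.+1 (fun v => `[< exists2 s : nat -> X,
      mkseq s k.+1 = v &
      iter k (step f eps s) (start f s) = Returned R (argmin f) >])).
split=> //.
pose S := \sum_(A | wrong_output f A) set_weight f (quota eps) A.
have S_lt : S < eps.
  have := sum_wrong_weight_lt f eps_gt0 a12 kap1 (@quota_ge R eps).
  by rewrite mulfVK// gt_eqF.
(* A common bound for all quotas a run can meet, since [m <= #|X|.+1]. *)
pose N := (\sum_(m < #|X|.+2) quota eps m)%N.
have quota_le m : (m <= #|X|.+1)%N -> (quota eps m <= N)%N.
  by rewrite -ltnS => mX; rewrite /N (bigD1 (Ordinal mX)) //= leq_addr.
have wmin := weight_argmin_gt0 p_distr p_fair X_nonempty.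
have wmin1 := weight_le1 p_distr (argmin f).
pose rho := 1 - weight p (argmin f) / 2.
(* The probability of fewer than [N] minimizers decays geometrically in [n], so it fits into the
   slack [eps - S]. *)
have [n n_gt0 n_small] : exists2 n, (0 < n)%N & 2 ^+ N * rho ^+ n < eps - S.
  have : (2 ^+ N * rho ^+ n) @[n --> \oo] --> (0 : R).
    by apply: (@cvg_geometric _ (2 ^+ N) rho); rewrite ger0_norm /rho; lra.
  move=> /cvgrPdist_lt /(_ (eps - S)); rewrite subr_gt0 => /(_ S_lt) [n0 _ Hn].
  exists n0.+1 => //; have := Hn n0.+1 (leqnSn n0).
  by rewrite /= sub0r normrN => /(le_lt_trans (ler_norm _)).
pose bad v A := first_hits_in (below f A) A (quota eps #|A|.+1) v.
pose good v := (N <= count (mem (argmin f)) v)%N &&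
  ~~ [exists A, wrong_output f A && bad v A].
have good_success : [set w | good (prefix_of Y n w)] `<=` success.
  move=> w /= /andP[hits nbad].
  have [//|[A wA bA]] := returned_argmin_or_wrong quota_le hits n_gt0.
  by move: nbad => /existsP; case; exists A; rewrite wA.
have mgood := measurable_prefix_of Y_samples n good.
apply: (@lt_le_trans _ _ (P [set w | good (prefix_of Y n w)])); last first.
  by apply: le_measure; rewrite ?inE.
rewrite (prob_prefix p_distr Y_samples) lte_fin.
have bad_le A : wrong_output f A ->
    word_mean p n (fun v => (bad v A)%:R) <= set_weight f (quota eps) A.
  move=> /and3P[A0 fA _].
  have wB : 0 < weight p (below f A).
    by apply: lt_le_trans wmin (weight_subset p_distr (argmin_sub_below f A0)).
  have AB : A \subset below f A.
    by apply/fintype.subsetP => x xA; rewrite inE; apply/exists_inP; exists x.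
  apply: le_trans (word_mean_first_hits p_distr _ n AB wB) _.
  apply: lerXn2r; rewrite ?nnegrE ?divr_ge0 ?weight_ge0//.
  exact: wrong_ratio_le.
have few_le := word_mean_few_hits p_distr (argmin f) N n.
(* On every word at least one of the three kinds of indicator equals [1]. *)
have cover : 1 <= word_mean p n (fun v => (good v)%:R) +
    \sum_(A | wrong_output f A) word_mean p n (fun v => (bad v A)%:R) +
    word_mean p n (fun v => (count (mem (argmin f)) v < N)%N%:R).
  rewrite -(word_mean_sum p_distr) -!(word_meanD p) -[leLHS](word_mean_cst p_distr n).
  apply: le_word_mean => // v; rewrite /good.
  have [hits|few] := leqP N; last by rewrite lerDr addr_ge0 ?sumr_ge0.
  rewrite addr0 /=; have [/existsP[A /andP[wA bA]]|_] :=
    boolP [exists A, wrong_output f A && bad v A].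
    by rewrite add0r (bigD1 A)//= bA lerDl sumr_ge0.
  by rewrite lerDl sumr_ge0.
have bads_le : \sum_(A | wrong_output f A) word_mean p n (fun v => (bad v A)%:R) <= S.
  exact: ler_sum.
exact: complement_lt cover bads_le few_le n_small.
Qed.
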